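(* Assume that $\Gamma(X)^T\Gamma(X)$ is almost surely invertible and $m\le Cn$ for some constant $C$. Assume that $f,\gamma_1,\dots,\gamma_n$ belong to $L^2(\Omega)$ and that $K_2(\Gamma)<+\infty$. Let $\alpha$ be the solution of the least-squares problem of minimizing $\|f-\sum_{j=1}^n a_j\gamma_j\|_{L^2(\Omega)}^2$ over $a\in\mathbb{R}^n$, and let $\bar\beta=\mathbb{E}\beta$. Then there exists a constant $C(n)$, depending on $n$ (and on $C$ and $K_2(\Gamma)$) but not on $f$, such that $$\|\bar\beta-\alpha\|_2\le C(n)\,\|\rho(\alpha)\|_{L^2(\Omega)}.$$
   Context: $(\Omega,\mu)$ is a probability space, $n,m\ge1$ are integers, and $f,\gamma_1,\dots,\gamma_n:\Omega\to\mathbb{R}$ are functions. For $a\in\mathbb{R}^n$ the residue is $\rho(a)(x)=f(x)-\sum_{j=1}^n a_j\gamma_j(x)$. When the Gram matrix $\langle\gamma,\gamma^T\rangle_{L^2}=(\langle\gamma_i,\gamma_j\rangle_{L^2})_{i,j}$ is invertible, the least-squares solution is $\alpha=\langle\gamma,\gamma^T\rangle_{L^2}^{-1}\langle\gamma,f\rangle_{L^2}$. $X=(X^{(1)},\dots,X^{(m)})$ where $X^{(1)},\dots,X^{(m)}$ are i.i.d. random points of $\Omega$ with distribution $\mu$. $F(X)=(f(X^{(1)}),\dots,f(X^{(m)}))^T\in\mathbb{R}^m$, and $\Gamma(X)$ is the random $m\times n$ matrix with entries $\Gamma_{ij}(X)=\gamma_j(X^{(i)})$. The random vector $\beta\in\mathbb{R}^n$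 is $\beta=(\Gamma(X)^T\Gamma(X))^{-1}\Gamma(X)^TF(X)$. $s_1(\Gamma(X))$ is the smallest eigenvalue of $\Gamma(X)^T\Gamma(X)$, and $K_2(\Gamma)=\mathbb{E}\,[s_1(\Gamma(X))^{-1}]$. $\|\cdot\|_2$ is the Euclidean norm on $\mathbb{R}^n$. *)

(* Defs.v *)
From HB Require Import structures.
From mathcomp Require Export all_boot all_order all_algebra.
From mathcomp Require Export all_classical all_reals all_analysis.

Set Implicit Arguments.
Unset Strict Implicit.
Unset Printing Implicit Defensive.

Import Order.TTheory GRing.Theory Num.Theory.

Local Open Scope classical_set_scope.
Local Open Scope ring_scope.

(* The norm MathComp-Analysis puts on matrices is the sup norm, hence: *)
Definition norm2 (R : realType) (n : nat) (v : 'cV[R]_n) : R :=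
  Num.sqrt (\sum_(j < n) v j ord0 ^+ 2).

Definition residue (R : realType) (T : Type) (n : nat) (f : T -> R)
    (gamma : 'I_n -> T -> R) (a : 'cV[R]_n) : T -> R :=
  fun x => f x - \sum_(j < n) a j ord0 * gamma j x.

Definition least_squares_solution (R : realType) (d : measure_display)
    (T : measurableType d) (mu : probability T R) (n : nat) (f : T -> R)
    (gamma : 'I_n -> T -> R) (alpha : 'cV[R]_n) : Prop :=
  forall a : 'cV[R]_n,
    ('N[mu]_2%:E[EFin \o residue f gamma alpha] ^+ 2 <=
     'N[mu]_2%:E[EFin \o residue f gamma a] ^+ 2)%E.

Definition mutually_independent (R : realType) (dW dT : measure_display)
    (W : measurableType dW) (T : measurableType dT) (P : probability W R)
    (m : nat) (X : 'I_m -> {RV P >-> T}) : Prop :=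
  forall (J : {set 'I_m}) (A : 'I_m -> set T),
    (forall i, i \in J -> measurable (A i)) ->
    P (\bigcap_(i in [set` J]) (X i @^-1` A i)) =
      (\prod_(i in J) P (X i @^-1` A i))%E.

Definition iid_sample (R : realType) (dW dT : measure_display)
    (W : measurableType dW) (T : measurableType dT) (P : probability W R)
    (mu : probability T R) (m : nat) (X : 'I_m -> {RV P >-> T}) : Prop :=
  mutually_independent X /\
  forall i (A : set T), measurable A -> distribution P (X i) A = mu A.

Definition sample_vec (R : realType) (T : Type) (m : nat) (f : T -> R)
    (x : 'I_m -> T) : 'cV[R]_m :=
  \col_(i < m) f (x i).

Definition design_mx (R : realType) (T : Type) (n m : nat)
    (gamma : 'I_n -> T -> R) (x : 'I_m -> T) : 'M[R]_(m, n) :=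
  \matrix_(i < m, j < n) gamma j (x i).

Definition normal_mx (R : realType) (T : Type) (n m : nat)
    (gamma : 'I_n -> T -> R) (x : 'I_m -> T) : 'M[R]_n :=
  (design_mx gamma x)^T *m design_mx gamma x.

Definition estimator (R : realType) (T : Type) (n m : nat) (f : T -> R)
    (gamma : 'I_n -> T -> R) (x : 'I_m -> T) : 'cV[R]_n :=
  invmx (normal_mx gamma x) *m (design_mx gamma x)^T *m sample_vec f x.

(* For symmetric M with n > 0 the set of eigenvalues is finite and nonempty,
   so the infimum is attained. *)
Definition smallest_eigenvalue (R : realType) (n : nat) (M : 'M[R]_n) : R :=
  inf [set a : R | eigenvalue M a].

(* The inverse is taken in \bar R, where the inverse of 0 is +oo. *)
Definition K2 (R : realType) (dW dT : measure_display)
    (W : measurableType dW) (T : measurableType dT) (P : probability W R)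
    (n m : nat) (gamma : 'I_n -> T -> R) (X : 'I_m -> {RV P >-> T}) : \bar R :=
  (\int[P]_w ((smallest_eigenvalue (normal_mx gamma (X ^~ w)))%:E)^-1)%E.

(* Meaningful only when every component of Y is integrable. *)
Definition mean_vec (R : realType) (dW : measure_display)
    (W : measurableType dW) (P : probability W R) (n : nat)
    (Y : W -> 'cV[R]_n) : 'cV[R]_n :=
  \col_(j < n) fine ('E_P[fun w => Y w j ord0])%E.

(* Main.v *)
Require Import Defs.
From mathcomp Require Import measurable_realfun.
From mathcomp Require Import ring lra.

(** Write [G] for the design matrix, [s] for the smallest eigenvalue of [G^T G],
    [rho] for the residue of [alpha] and [r] for the vector of its samples.
    Where [G^T G] is invertible, the estimator applied to the combination with
    coefficients [alpha] returns [alpha], so that [beta - alpha = y] with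
    [y = (G^T G)^-1 G^T r] ([estimator_error]). Now [G y] is the orthogonal
    projection of [r] on the range of [G], whence
    [s |y|^2 <= <y, G^T G y> = |G y|^2 <= |r|^2]
    ([least_squares_stable]). The Cauchy-Schwarz inequality then gives
    [E |beta - alpha| <= sqrt (E [1 / s]) sqrt (E |r|^2)], and
    [E |r|^2 = m |rho|^2] because every sample point has law [mu]
    ([integral_sqr_norm2_sample_vec]). As the norm of a mean is at most the mean
    of the norm ([norm2_mean_vec_le]) and [m <= C n], the constant
    [sqrt (C n K_2)] works; the same bound on [E |beta - alpha|] makes the
    components of [beta] integrable.

    Two points need an argument. The first is that [s |y|^2 <= <y, G^T G y>]
    where [s] is the infimum of the spectrum. Instead of diagonalizing, take the
    largest [t] for which [G^T G - t] is positive semidefinite. If that matrix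
    were invertible it would be coercive and [t] could be increased, so [t] is
    an eigenvalue ([psdmx_shift_eigenvalue]) and [s <= t].

    The second is that [1 / s] enters only through its integral, a supremum over
    the simple functions below it, which spares a proof that [s] is measurable.
    The Cauchy-Schwarz step therefore goes through the quotient
    [|beta - alpha| / |r|], which is measurable and whose square is almost surely
    at most [1 / s] ([cauchy_schwarz_dominated]). *)

Import Order.TTheory GRing.Theory Num.Theory.
Local Open Scope classical_set_scope.
Local Open Scope ring_scope.

(** * Positive semidefinite forms and the smallest eigenvalue *)

Section EuclideanSpace.
Set Implicit Arguments.
Unset Strict Implicit.
Context {R : realType}.

Definition dotc (n : nat) (u v : 'cV[R]_n) : R := (u^T *m v) ord0 ord0.

Lemma dotcE n (u v : 'cV[R]_n) : dotc u v = \sum_j u j ord0 * v j ord0.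
Proof. by rewrite /dotc mxE; apply: eq_bigr => j _; rewrite mxE. Qed.

Lemma dotcC n (u v : 'cV[R]_n) : dotc u v = dotc v u.
Proof. by rewrite !dotcE; apply: eq_bigr => j _; rewrite mulrC. Qed.

Lemma dotcDr n (u v w : 'cV[R]_n) : dotc u (v + w) = dotc u v + dotc u w.
Proof. by rewrite /dotc mulmxDr mxE. Qed.

Lemma dotcZr n a (u v : 'cV[R]_n) : dotc u (a *: v) = a * dotc u v.
Proof. by rewrite /dotc -scalemxAr mxE. Qed.

Lemma dotcBr n (u v w : 'cV[R]_n) : dotc u (v - w) = dotc u v - dotc u w.
Proof. by rewrite -scaleN1r dotcDr dotcZr mulN1r. Qed.

Lemma dotcBl n (u v w : 'cV[R]_n) : dotc (v - w) u = dotc v u - dotc w u.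
Proof. by rewrite dotcC dotcBr !(dotcC u). Qed.

Lemma dotcZl n a (u v : 'cV[R]_n) : dotc (a *: v) u = a * dotc v u.
Proof. by rewrite dotcC dotcZr dotcC. Qed.

Lemma dotc_mulmxr m n (A : 'M[R]_(m, n)) u v :
  dotc u (A *m v) = dotc (A^T *m u) v.
Proof. by rewrite /dotc trmx_mul trmxK mulmxA. Qed.

Lemma dotc_ge0 n (u : 'cV[R]_n) : 0 <= dotc u u.
Proof. by rewrite dotcE; apply: sumr_ge0 => j _; exact: sqr_ge0. Qed.

Lemma dotc_eq0 n (u : 'cV[R]_n) : dotc u u = 0 -> u = 0.
Proof.
rewrite dotcE => /eqP; rewrite psumr_eq0 => [/allP u0|j _]; last exact: sqr_ge0.
apply/matrixP => j k; rewrite ord1 mxE; apply/eqP.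
by have := u0 j (mem_index_enum j); rewrite mulf_eq0 orbb.
Qed.

Lemma norm2E n (u : 'cV[R]_n) : norm2 u = Num.sqrt (dotc u u).
Proof. by rewrite /norm2 dotcE. Qed.

Lemma norm2_ge0 n (u : 'cV[R]_n) : 0 <= norm2 u.
Proof. exact: sqrtr_ge0. Qed.

Lemma sqr_norm2 n (u : 'cV[R]_n) : norm2 u ^+ 2 = dotc u u.
Proof. by rewrite norm2E sqr_sqrtr// dotc_ge0. Qed.

Lemma norm2_0 n : norm2 (0 : 'cV[R]_n) = 0.
Proof. by rewrite norm2E /dotc mulmx0 mxE sqrtr0. Qed.

Lemma norm2_eq0 n (u : 'cV[R]_n) : norm2 u = 0 -> u = 0.
Proof. by move=> u0; apply: dotc_eq0; rewrite -sqr_norm2 u0 expr0n. Qed.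

Lemma entry_le_norm2 n (u : 'cV[R]_n) j : `|u j ord0| <= norm2 u.
Proof.
rewrite -sqrtr_sqr ler_wsqrtr// (bigD1 j)//= lerDl.
by apply: sumr_ge0 => k _; exact: sqr_ge0.
Qed.

Lemma dotc_le_norm2 n (u v : 'cV[R]_n) : dotc u v <= norm2 u * norm2 v.
Proof.
have [u0|u0] := eqVneq (norm2 u) 0.
  by rewrite u0 (norm2_eq0 u0) dotcE big1 ?mul0r// => j _; rewrite mxE mul0r.
have [v0|v0] := eqVneq (norm2 v) 0.
  by rewrite v0 (norm2_eq0 v0) dotcE big1 ?mulr0// => j _; rewrite mxE mulr0.
have a0 : 0 < norm2 u by rewrite lt0r u0 norm2_ge0.
have b0 : 0 < norm2 v by rewrite lt0r v0 norm2_ge0.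
(* [u] and [v] rescaled to a common length: expanding the square of their
   difference gives the inequality multiplied by [2 * |u| * |v|]. *)
have := dotc_ge0 (norm2 v *: u - norm2 u *: v).
rewrite dotcBr !dotcBl !dotcZr !dotcZl (dotcC v u) -!sqr_norm2.
move: (dotc u v) => c h.
have ab0 : 0 < 2 * (norm2 u * norm2 v) by rewrite !mulr_gt0.
rewrite -(ler_pM2l ab0) -subr_ge0.
by move: h; congr (0 <= _); ring.
Qed.

Lemma cauchy_schwarz_dotc n (u v : 'cV[R]_n) :
  `|dotc u v| <= norm2 u * norm2 v.
Proof.
have normN : norm2 ((-1) *: v) = norm2 v.
  by rewrite !norm2E dotcZl dotcZr !mulN1r opprK.
rewrite ler_norml dotc_le_norm2 andbT lerNl -mulN1r -dotcZr -normN.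
exact: dotc_le_norm2.
Qed.

(** A condition on the quadratic form alone: symmetry, which the usual notion
    includes, is assumed separately. *)
Definition psdmx (n : nat) (A : 'M[R]_n) : Prop :=
  forall y : 'cV[R]_n, 0 <= dotc y (A *m y).

(** Each term [y_i B_ij y_j] is at most [|B_ij| |y|^2]; the summand [1] in the
    constant makes it positive, hence invertible, even for [B = 0]. *)
Lemma quad_form_bound n (B : 'M[R]_n) :
  exists2 M : R, 0 < M & forall y, dotc y (B *m y) <= M * dotc y y.
Proof.
exists (1 + \sum_i \sum_j `|B i j|).
  by rewrite ltr_wpDr// sumr_ge0// => i _; exact: sumr_ge0.
move=> y; rewrite mulrDl mul1r ler_wpDl ?dotc_ge0//.
rewrite dotcE mulr_suml; apply: ler_sum => i _.
rewrite mxE mulr_sumr mulr_suml; apply: ler_sum => j _.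
have yle k : `|y k ord0| ^+ 2 <= dotc y y.
  by rewrite -sqr_norm2 ler_pXn2r ?nnegrE ?norm2_ge0// entry_le_norm2.
rewrite (le_trans (ler_norm _))// !normrM mulrCA ler_wpM2l//.
have := yle i; have := yle j; have := sqr_ge0 (`|y i ord0| - `|y j ord0|).
nra.
Qed.

(** Positivity of the form at [y - t *: A^-1 y] reads
    [0 <= <y, A y> - 2 t |y|^2 + t^2 <y, A^-1 y>]. With [<y, A^-1 y> <= M |y|^2]
    and [t = 1 / M] this becomes [|y|^2 / M <= <y, A y>]. *)
Lemma psdmx_unit_coercive n (A : 'M[R]_n) : A^T = A -> psdmx A ->
  A \in unitmx -> exists2 e : R, 0 < e & psdmx (A - e%:M).
Proof.
move=> sA pA uA; have [M M0 HM] := quad_form_bound (invmx A).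
exists M^-1; rewrite ?invr_gt0// => y.
have := pA (y - M^-1 *: (invmx A *m y)).
rewrite mulmxBr -scalemxAr mulKVmx// dotcBr !dotcBl !dotcZr !dotcZl.
rewrite (dotc_mulmxr A (invmx A *m y)) sA mulKVmx// (dotcC (invmx A *m y)).
rewrite mulmxBl mul_scalar_mx dotcBr dotcZr.
have := HM y; rewrite -(ler_pM2l (_ : 0 < M^-1)) ?invr_gt0// mulKf ?gt_eqF//.
rewrite -(ler_pM2l (_ : 0 < M^-1)) ?invr_gt0//.
nra.
Qed.

Lemma dotc_delta n (i : 'I_n) :
  dotc (delta_mx i ord0) (delta_mx i ord0) = 1 :> R.
Proof.
rewrite dotcE (bigD1 i)//= big1 => [|j /negPf ji]; rewrite !mxE ?eqxx ?ji//=.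
  by rewrite mulr1 addr0.
by rewrite mul0r.
Qed.

(** The largest [t] with [A - t%:M] positive semidefinite is an eigenvalue,
    as otherwise coercivity of [A - t%:M] would let [t] grow. *)
Lemma psdmx_shift_eigenvalue n (A : 'M[R]_n) : (0 < n)%N -> A^T = A ->
  psdmx A -> exists2 a : R, eigenvalue A a & psdmx (A - a%:M).
Proof.
move=> n0 sA pA; pose S := [set t : R | psdmx (A - t%:M)].
have S0 : S 0 by rewrite /S /=; have -> : A - 0%:M = A by rewrite raddf0 subr0.
have SE t y : dotc y ((A - t%:M) *m y) = dotc y (A *m y) - t * dotc y y.
  by rewrite mulmxBl mul_scalar_mx dotcBr dotcZr.
have supS : has_sup S.
  split; first by exists 0.
  (* Testing on a unit vector bounds the shifts from above. *)
  pose e : 'cV[R]_n := delta_mx (Ordinal n0) ord0.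
  exists (dotc e (A *m e)) => t /(_ e).
  by rewrite SE dotc_delta mulr1 subr_ge0.
have pS : psdmx (A - (sup S)%:M).
  move=> y; rewrite SE subr_ge0.
  have [y0|y0] := eqVneq (dotc y y) 0.
    by rewrite y0 mulr0; exact: pA.
  have y1 : 0 < dotc y y by rewrite lt0r y0 dotc_ge0.
  rewrite -ler_pdivlMr//; apply: ge_sup; first by exists 0.
  by move=> t /(_ y); rewrite SE subr_ge0 ler_pdivlMr.
exists (sup S) => //; rewrite /eigenvalue /eigenspace.
apply/negP => /eqP/eqP; rewrite kermx_eq0 row_free_unit => uA.
have sS : (A - (sup S)%:M)^T = A - (sup S)%:M.
  by rewrite linearB /= tr_scalar_mx sA.
have [e e0 pe] := psdmx_unit_coercive sS pS uA.
suff : sup S + e <= sup S by rewrite gerDl leNgt e0.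
apply: ub_le_sup; first by case: supS.
by rewrite /S /= raddfD /= opprD addrA.
Qed.

Lemma psdmx_eigenvalue_ge0 n (A : 'M[R]_n) a :
  A^T = A -> psdmx A -> eigenvalue A a -> 0 <= a.
Proof.
move=> sA pA /eigenvalueP[v vA v0].
have := pA v^T; rewrite -{1}sA -trmx_mul vA linearZ/= dotcZr => h.
rewrite leNgt; apply/negP => a0; move/negP: v0; apply.
have : dotc v^T v^T = 0.
  by apply/eqP; rewrite eq_le dotc_ge0 andbT -(ler_nM2l a0) mulr0.
by move/dotc_eq0/(congr1 trmx); rewrite trmxK trmx0 => ->.
Qed.

Lemma smallest_eigenvalue_ge0 n (A : 'M[R]_n) : (0 < n)%N ->
  A^T = A -> psdmx A -> 0 <= smallest_eigenvalue A.
Proof.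
move=> n0 sA pA; have [a ea _] := psdmx_shift_eigenvalue n0 sA pA.
apply: lb_le_inf; first by exists a.
by move=> b; exact: psdmx_eigenvalue_ge0.
Qed.

(** The lower Rayleigh bound: the infimum of the spectrum lies below the
    eigenvalue by which the form can be shifted. *)
Lemma smallest_eigenvalue_le_quad n (A : 'M[R]_n) y : (0 < n)%N ->
  A^T = A -> psdmx A ->
  smallest_eigenvalue A * dotc y y <= dotc y (A *m y).
Proof.
move=> n0 sA pA; have [a ea /(_ y)] := psdmx_shift_eigenvalue n0 sA pA.
rewrite mulmxBl mul_scalar_mx dotcBr dotcZr subr_ge0; apply: le_trans.
rewrite ler_wpM2r ?dotc_ge0//; apply: ge_inf => //.
by exists 0 => b; exact: psdmx_eigenvalue_ge0.
Qed.

Section LeastSquares.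
Context {m n : nat} (G : 'M[R]_(m, n)).

Lemma gram_sym : (G^T *m G)^T = G^T *m G.
Proof. by rewrite trmx_mul trmxK. Qed.

Lemma dotc_gram y : dotc y (G^T *m G *m y) = dotc (G *m y) (G *m y).
Proof. by rewrite -mulmxA dotc_mulmxr trmxK. Qed.

Lemma gram_psd : psdmx (G^T *m G).
Proof. by move=> y; rewrite dotc_gram dotc_ge0. Qed.

(** For [y] the least-squares solution, [G y] is the orthogonal projection of
    [r] on the range of [G], hence no longer than [r], and its squared length is
    the form of [G^T G] at [y], which dominates [s |y|^2]. *)
Lemma least_squares_stable (r : 'cV[R]_m) : (0 < n)%N ->
  G^T *m G \in unitmx ->
  smallest_eigenvalue (G^T *m G) *
    norm2 (invmx (G^T *m G) *m G^T *m r) ^+ 2 <= norm2 r ^+ 2.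
Proof.
move=> n0 uG; set y := _ *m r; rewrite !sqr_norm2.
have := smallest_eigenvalue_le_quad y n0 gram_sym gram_psd.
move=> /le_trans; apply; rewrite dotc_gram.
have normal_eq : G^T *m (G *m y) = G^T *m r.
  by rewrite /y !mulmxA mulmxV// mul1mx.
have := dotc_ge0 (r - G *m y).
rewrite dotcBr !dotcBl (dotcC (G *m y) r) !(dotc_mulmxr G) normal_eq.
lra.
Qed.

End LeastSquares.
End EuclideanSpace.

(** * Measurability and integral inequalities *)

Section Integrals.
Set Implicit Arguments.
Unset Strict Implicit.
Context {R : realType} {d : measure_display} {W : measurableType d}.

(** The integral of a nonnegative function is a supremum over the simple
    functions below it, so monotonicity needs no measurability. It is applied
    with the inverse of the smallest eigenvalue on the right. *)
Lemma le_integral_nonmeasurable (mu : {measure set W -> \bar R})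
    (f g : W -> \bar R) :
  (forall x, 0 <= f x)%E -> (forall x, f x <= g x)%E ->
  (\int[mu]_x f x <= \int[mu]_x g x)%E.
Proof.
move=> f0 fg; rewrite !ge0_integralTE => [||//].
  apply: le_ereal_sup => _ [h hf <-]; exists h => // x.
  exact: le_trans (fg x).
by move=> x; exact: le_trans (fg x).
Qed.

(** Since [0^-1 = 0], the inverse of [x] is always [x * (x ^+ 2)^-1], and on
    nonnegative reals the inverse is the measurable power of exponent [-1]. *)
Lemma measurable_funV (f : W -> R) : measurable_fun setT f ->
  measurable_fun setT (fun x => (f x)^-1).
Proof.
move=> mf; rewrite (_ : (fun x => _) = (fun x => f x * powR (f x ^+ 2) (-1))).
  apply: measurable_funM => //.
  by apply: (measurableT_comp (measurable_powR _)); exact: measurable_funX.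
apply/funext => x; rewrite powR_inv1 ?sqr_ge0//.
have [->|fx0] := eqVneq (f x) 0; first by rewrite invr0 mul0r.
by rewrite expr2 invfM mulrA divff// mul1r.
Qed.

Lemma measurable_fun_sqrt (f : W -> R) : measurable_fun setT f ->
  measurable_fun setT (fun x => Num.sqrt (f x)).
Proof.
apply: measurableT_comp; apply: continuous_measurable_fun.
exact: sqrt_continuous.
Qed.

Definition measurable_mx m n (A : W -> 'M[R]_(m, n)) : Prop :=
  forall i j, measurable_fun setT (fun w => A w i j).

Lemma measurable_mulmx m n p (A : W -> 'M[R]_(m, n)) (B : W -> 'M[R]_(n, p)) :
  measurable_mx A -> measurable_mx B -> measurable_mx (fun w => A w *m B w).
Proof.
move=> mA mB i j; under eq_fun do rewrite mxE.
by apply: measurable_sum => k; exact: measurable_funM.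
Qed.

Lemma measurable_trmx m n (A : W -> 'M[R]_(m, n)) :
  measurable_mx A -> measurable_mx (fun w => (A w)^T).
Proof. by move=> mA i j; under eq_fun do rewrite mxE; exact: mA. Qed.

Lemma measurable_det n (A : W -> 'M[R]_n) :
  measurable_mx A -> measurable_fun setT (fun w => \det (A w)).
Proof.
move=> mA; apply: measurable_sum => s; apply: measurable_funM => //.
by apply: measurable_prod => i _; exact: mA.
Qed.

(** Cramer's rule makes the entries of the inverse rational in those of the
    matrix; where the determinant vanishes [invmx] is the identity map. *)
Lemma measurable_invmx n (A : W -> 'M[R]_n) :
  measurable_mx A -> measurable_mx (fun w => invmx (A w)).
Proof.
move=> mA i j.
have invE w : invmx (A w) i j = if \det (A w) == 0 then A w i j else
    (\det (A w))^-1 * ((-1) ^+ (j + i) * \det (row' j (col' i (A w)))).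
  by rewrite /invmx unitmxE unitfE; case: eqP => //= _; rewrite !mxE.
under eq_fun do rewrite invE.
apply: measurable_fun_ifT.
- apply: measurable_fun_eqr => //; exact: measurable_det.
- exact: mA.
apply: measurable_funM; first exact/measurable_funV/measurable_det.
apply: measurable_funM => //; apply: measurable_det => k l.
by under eq_fun do rewrite !mxE; exact: mA.
Qed.

Lemma measurable_norm2 n (Y : W -> 'cV[R]_n) :
  measurable_mx Y -> measurable_fun setT (fun w => norm2 (Y w)).
Proof.
move=> mY; apply: measurable_fun_sqrt; apply: measurable_sum => j.
exact: measurable_funX.
Qed.

Lemma Lnorm2_sqr (mu : {measure set W -> \bar R}) (f : W -> R) :
  ('N[mu]_2%:E[EFin \o f] `^ 2 = \int[mu]_x (f x ^+ 2)%:E)%E.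
Proof.
rewrite powR_Lnorm//; apply: eq_integral => x _.
by rewrite abse_EFin poweR_EFin powR_mulrn// real_normK ?num_real.
Qed.

Lemma Lfun2_integral_sqr (mu : {measure set W -> \bar R}) (f : W -> R) :
  f \in Lfun mu 2%:E ->
  (\int[mu]_x (f x ^+ 2)%:E = (fine 'N[mu]_2%:E[EFin \o f] ^+ 2)%:E)%E.
Proof.
rewrite inE => /andP[_]; rewrite inE /= /finite_norm -Lnorm2_sqr => fN.
rewrite -{1}(@fineK _ 'N[mu]_2%:E[EFin \o f]%E).
  by rewrite poweR_EFin powR_mulrn// fine_ge0// Lnorm_ge0.
by rewrite ge0_fin_numE ?Lnorm_ge0.
Qed.

Lemma Lnorm2_le (mu : {measure set W -> \bar R}) (f : W -> R) (A : R) :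
  (\int[mu]_x (f x ^+ 2)%:E <= A%:E)%E ->
  ('N[mu]_2%:E[EFin \o f] <= (Num.sqrt A)%:E)%E.
Proof.
rewrite -Lnorm2_sqr; have := Lnorm_ge0 mu 2%:E (EFin \o f).
case: ('N[mu]_2%:E[_])%E => [r| |]//=; last by rewrite pnatr_eq0.
rewrite !lee_fin => r0; rewrite powR_mulrn// => rA.
by rewrite -(ger0_norm r0) -sqrtr_sqr ler_wsqrtr.
Qed.

(** For measurable [k] this would be the Cauchy-Schwarz inequality for [sqrt k]
    and [S]. In general, [D / S] takes the place of [sqrt k]: it is measurable
    and its square is at most [k] almost everywhere. *)
Lemma cauchy_schwarz_dominated (P : {measure set W -> \bar R})
    (D S : W -> R) (k : W -> \bar R) (A B : R) :
  measurable_fun setT D -> measurable_fun setT S ->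
  (forall w, 0 <= D w) -> (forall w, 0 <= S w) -> (forall w, 0 <= k w)%E ->
  (\forall w \ae P, ((D w ^+ 2)%:E <= k w * (S w ^+ 2)%:E)%E) ->
  (\int[P]_w k w <= A%:E)%E -> (\int[P]_w (S w ^+ 2)%:E <= B%:E)%E ->
  (\int[P]_w (D w)%:E <= (Num.sqrt A * Num.sqrt B)%:E)%E.
Proof.
move=> mD mS D0 S0 k0 [N [mN PN DkN]] kA SB.
(* Cutting off the null set [N] makes [h ^+ 2 <= k] hold everywhere, which the
   comparison with the integral of a nonmeasurable [k] requires. *)
pose h w := \1_(~` N) w * (D w / S w).
have mh : measurable_fun setT h.
  apply: measurable_funM; first exact/measurable_indicP/measurableC.
  exact/measurable_funM/measurable_funV.
have DkS w : ~ N w -> ((D w ^+ 2)%:E <= k w * (S w ^+ 2)%:E)%E.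
  by move=> Nw; apply: contrapT => Dk; exact/Nw/DkN.
have hk w : ((h w ^+ 2)%:E <= k w)%E.
  rewrite /h indicE; have [wN|wN] := boolP (w \in ~` N); last first.
    by rewrite mul0r expr0n.
  rewrite mul1r; have [->|Sw] := eqVneq (S w) 0.
    by rewrite invr0 mulr0 expr0n.
  have := DkS w (set_mem wN); case: (k w) (k0 w) => [r| |]//.
    by rewrite !lee_fin expr_div_n ler_pdivrMr ?exprn_gt0 ?lt0r ?Sw ?S0.
  by move=> _ _; rewrite leey.
have hD : (\int[P]_w (D w)%:E <= \int[P]_w `|(h w * S w)%:E|)%E.
  apply: ae_ge0_le_integral => //.
  - by move=> w _; rewrite lee_fin.
  - exact/measurable_EFinP.
  - apply: measurableT_comp => //; apply/measurable_EFinP.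
    exact: measurable_funM.
  exists N; split=> // w; apply: contra_notP => wN _.
  rewrite abse_EFin lee_fin /h indicE mem_set// mul1r.
  (* Where [S] vanishes so does [D], even if [k] is infinite: [+oo * 0 = 0]. *)
  have [Sw|Sw] := eqVneq (S w) 0; last by rewrite divfK// ger0_norm.
  have := DkS w wN; rewrite Sw expr0n mule0 lee_fin => Dw.
  suff /eqP -> : D w == 0 by rewrite mulr0 normr0.
  by rewrite -sqrf_eq0 eq_le Dw sqr_ge0.
apply: (le_trans hD); rewrite -Lnorm1.
have half : 2^-1 + 2^-1 = 1 :> R by rewrite [RHS]splitr !div1r.
apply: (le_trans (@hoelder _ _ _ P h S 2 2 mh mS _ _ half)) => //.
rewrite EFinM; apply: lee_pmul; rewrite ?Lnorm_ge0//; apply: Lnorm2_le => //.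
apply: le_trans kA; apply: le_integral_nonmeasurable => // w.
by rewrite lee_fin sqr_ge0.
Qed.

(** For [v] the mean, [|v|^2 = E <v, Y>], and the Cauchy-Schwarz inequality for
    vectors bounds the right-hand side by [|v| E |Y|]. *)
Lemma norm2_mean_vec_le (P : probability W R) n (Y : W -> 'cV[R]_n) :
  (forall j, (fun w => Y w j ord0) \in Lfun P 1%:E) ->
  ((norm2 (mean_vec P Y))%:E <= \int[P]_w (norm2 (Y w))%:E)%E.
Proof.
move=> LY; set v := mean_vec P Y.
have iY j : P.-integrable setT (fun w => (Y w j ord0)%:E).
  exact/Lfun1_integrable.
have mY : measurable_mx Y.
  move=> j k; rewrite ord1; apply/measurable_EFinP.
  exact: measurable_int (iY j).
have [v0|v0] := eqVneq (norm2 v) 0.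
  by rewrite v0; apply: integral_ge0 => w _; rewrite lee_fin norm2_ge0.
have vpos : 0 < norm2 v by rewrite lt0r v0 norm2_ge0.
have ivY j : P.-integrable setT (fun w => (v j ord0)%:E * (Y w j ord0)%:E)%E.
  exact: integrableZl.
have Ev : (\int[P]_w (dotc v (Y w))%:E = (norm2 v ^+ 2)%:E)%E.
  rewrite sqr_norm2 dotcE -sumEFin.
  under eq_integral do rewrite dotcE -sumEFin.
  under eq_integral do under eq_bigr do rewrite EFinM.
  rewrite integral_sum//; apply: eq_bigr => j _.
  rewrite integralZl// /v !mxE EFinM; congr (_ * _)%E.
  by rewrite fineK ?expectation_fin_num// unlock.
rewrite -(@lee_pmul2l _ (norm2 v)%:E)// ?lte_fin//.
rewrite -EFinM -expr2 -Ev -ge0_integralZl//; last 3 first.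
- exact/measurable_EFinP/measurable_norm2.
- by move=> w _; rewrite lee_fin norm2_ge0.
- by rewrite lee_fin norm2_ge0.
under [leRHS]eq_integral do rewrite -EFinM.
have mdot : measurable_fun setT (fun w => (dotc v (Y w))%:E).
  apply/measurable_EFinP; under eq_fun do rewrite dotcE.
  by apply: measurable_sum => j; exact: measurable_funM.
apply: le_trans (lee_abs _) _; apply: le_trans (le_abse_integral _ _ _) _ => //.
apply: ge0_le_integral => //.
- exact: measurableT_comp.
- apply/measurable_EFinP; apply: measurable_funM => //.
  exact: measurable_norm2.
- by move=> w _; rewrite abse_EFin lee_fin cauchy_schwarz_dotc.
Qed.

Lemma mean_vec_subr (P : probability W R) n (Y : W -> 'cV[R]_n) (a : 'cV[R]_n) :
  (forall j, (fun w => Y w j ord0) \in Lfun P 1%:E) ->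
  mean_vec P (fun w => Y w - a) = mean_vec P Y - a.
Proof.
move=> LY; apply/matrixP => j k; rewrite ord1 !mxE.
under [X in expectation P X]eq_fun do rewrite !mxE.
rewrite (expectationB (LY j) (Lfun_cst _ (a j ord0) 1)) expectation_cst.
by rewrite fineB ?expectation_fin_num.
Qed.

Lemma Lfun1_dominated (P : {measure set W -> \bar R}) (f g : W -> R) :
  measurable_fun setT f -> (forall w, `|f w| <= g w) ->
  (\int[P]_w (g w)%:E < +oo)%E -> f \in Lfun P 1%:E.
Proof.
move=> mf fg gfin; apply/Lfun1_integrable/integrableP; split.
  exact/measurable_EFinP.
apply: le_lt_trans gfin; apply: le_integral_nonmeasurable => w.
  exact: abse_ge0.
by rewrite abse_EFin lee_fin.
Qed.

End Integrals.

(** * The error of the estimator *)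

Section SampledLeastSquares.
Set Implicit Arguments.
Unset Strict Implicit.
Context {R : realType} {T : Type} {n m : nat}.
Variables (f : T -> R) (gamma : 'I_n -> T -> R) (alpha : 'cV[R]_n).

Lemma sample_vec_residue (x : 'I_m -> T) :
  sample_vec (residue f gamma alpha) x =
  sample_vec f x - design_mx gamma x *m alpha.
Proof.
apply/matrixP => i j; rewrite !mxE /residue; congr (_ - _).
apply: eq_bigr => k _.
by rewrite (ord1 j) !mxE mulrC.
Qed.

(** The estimator reproduces [alpha] exactly from the samples of the
    combination with coefficients [alpha], so only the residue is left. *)
Lemma estimator_error (x : 'I_m -> T) : normal_mx gamma x \in unitmx ->
  estimator f gamma x - alpha =
  invmx (normal_mx gamma x) *m (design_mx gamma x)^T *m
    sample_vec (residue f gamma alpha) x.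
Proof.
move=> u; rewrite sample_vec_residue mulmxBr; congr (_ - _).
by rewrite mulmxA -(mulmxA (invmx _)) mulVmx// mul1mx.
Qed.

Lemma inv_smallest_eigenvalue_ge0 (x : 'I_m -> T) : (0 < n)%N ->
  (0 <= ((smallest_eigenvalue (normal_mx gamma x))%:E)^-1)%E.
Proof.
move=> n0; rewrite inve_ge0 lee_fin; apply: smallest_eigenvalue_ge0 => //.
  exact: gram_sym.
exact: gram_psd.
Qed.

(** If the smallest eigenvalue were [0], its inverse would be [+oo] and the
    product on the right could vanish only for zero residues, for which the error
    vanishes too; otherwise this is [least_squares_stable]. *)
Lemma norm2_estimator_error_le (x : 'I_m -> T) : (0 < n)%N ->
  normal_mx gamma x \in unitmx ->
  ((norm2 (estimator f gamma x - alpha) ^+ 2)%:E <=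
    ((smallest_eigenvalue (normal_mx gamma x))%:E)^-1 *
    (norm2 (sample_vec (residue f gamma alpha) x) ^+ 2)%:E)%E.
Proof.
move=> n0 u; rewrite (estimator_error u).
set r := sample_vec _ x; have := least_squares_stable r n0 u.
rewrite -/(normal_mx gamma x) inver.
have := smallest_eigenvalue_ge0 n0 (gram_sym (design_mx gamma x)) (gram_psd _).
rewrite -/(normal_mx gamma x).
move: (smallest_eigenvalue _) => s s0; case: eqP => [_ _|/eqP sN0 h].
  have [r0|r0] := eqVneq (norm2 r) 0.
    by rewrite r0 (norm2_eq0 r0) mulmx0 norm2_0 !expr0n /= mule0.
  by rewrite gt0_mulye ?leey// lte_fin exprn_gt0// lt0r r0 norm2_ge0.
by rewrite -EFinM lee_fin mulrC ler_pdivlMr ?lt0r ?sN0// mulrC.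
Qed.

End SampledLeastSquares.

(** * Moments of the sample *)

Section SampleMoments.
Set Implicit Arguments.
Unset Strict Implicit.
Context {R : realType} {dT dW : measure_display} {T : measurableType dT}
  {W : measurableType dW} {mu : probability T R} {P : probability W R} {m : nat}.
Variable X : 'I_m -> {RV P >-> T}.

Lemma measurable_sample_vec (g : T -> R) : measurable_fun setT g ->
  measurable_mx (fun w => sample_vec g (X ^~ w)).
Proof.
move=> mg i j; under eq_fun do rewrite mxE.
exact: measurableT_comp.
Qed.

Lemma measurable_estimator n (f : T -> R) (gamma : 'I_n -> T -> R) :
  measurable_fun setT f -> (forall j, measurable_fun setT (gamma j)) ->
  measurable_mx (fun w => estimator f gamma (X ^~ w)).
Proof.
move=> mf mg.
have mG : measurable_mx (fun w => design_mx gamma (X ^~ w)).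
  by move=> i j; under eq_fun do rewrite mxE; exact: measurableT_comp.
apply: measurable_mulmx; last exact: measurable_sample_vec.
apply: measurable_mulmx; last exact: measurable_trmx.
apply: measurable_invmx; apply: measurable_mulmx => //.
exact: measurable_trmx.
Qed.

Lemma integral_sqr_norm2_sample_vec (g : T -> R) :
  (forall i A, measurable A -> distribution P (X i) A = mu A) ->
  g \in Lfun mu 2%:E ->
  (\int[P]_w (norm2 (sample_vec g (X ^~ w)) ^+ 2)%:E =
    (m%:R * fine 'N[mu]_2%:E[EFin \o g] ^+ 2)%:E)%E.
Proof.
move=> hX Lg; have mg : measurable_fun setT g.
  by move: Lg; rewrite inE => /andP[]; rewrite inE.
have mg2 : measurable_fun setT (fun t => (g t ^+ 2)%:E).
  by apply/measurable_EFinP; exact: measurable_funX.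
under eq_integral do rewrite sqr_norm2 dotcE -sumEFin.
rewrite ge0_integral_sum//; last 2 first.
- move=> i; apply/measurable_EFinP.
  by apply: measurable_funM; exact: measurable_sample_vec.
- by move=> i w _; rewrite lee_fin -expr2 sqr_ge0.
rewrite (eq_bigr (fun=> (fine 'N[mu]_2%:E[EFin \o g] ^+ 2)%:E)) => [|i _].
  by rewrite sumEFin sumr_const card_ord mulr_natl.
rewrite -Lfun2_integral_sqr//.
rewrite -(@eq_measure_integral _ _ _ _ mu (distribution P (X i))).
  rewrite ge0_integral_distribution//.
    by apply: eq_integral => w _ /=; rewrite mxE expr2.
  by move=> t; rewrite lee_fin sqr_ge0.
by move=> A mA _; exact: hX.
Qed.

End SampleMoments.

Lemma Lfun_residue (R : realType) (d : measure_display) (T : measurableType d)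
    (mu : probability T R) (n : nat) (f : T -> R) (gamma : 'I_n -> T -> R)
    (a : 'cV[R]_n) :
  f \in Lfun mu 2%:E -> (forall j, gamma j \in Lfun mu 2%:E) ->
  residue f gamma a \in Lfun mu 2%:E.
Proof.
move=> Lf Lg; have p1 : (1 <= 2%:E :> \bar R)%E by rewrite lee_fin ler1n.
have [L0 LD] := Lfun_addr_closed mu p1.
have LN := Lfun_oppr_closed (mu := mu) (p := 2%:E).
have Lsum s : (fun x => \sum_(j <- s) a j ord0 * gamma j x) \in Lfun mu 2%:E.
  elim: s => [|j s IHs].
    by under eq_fun do rewrite big_nil.
  under eq_fun do rewrite big_cons.
  apply: LD => //; under eq_fun do rewrite mulrC.
  by apply: Lfun_scale => //; rewrite ler1n.
exact: LD (LN _ (Lsum _)).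
Qed.

Theorem proposition3p5 (R : realType) :
  exists Cst : nat -> R -> R -> R,
  forall (n m : nat) (hn : (0 < n)%N) (hm : (0 < m)%N)
    (C : R) (hC : m%:R <= C * n%:R)
    (dT : measure_display) (T : measurableType dT) (mu : probability T R)
    (dW : measure_display) (W : measurableType dW) (P : probability W R)
    (X : 'I_m -> {RV P >-> T}) (hX : iid_sample mu X)
    (gamma : 'I_n -> T -> R) (hgamma : forall j, gamma j \in Lfun mu 2%:E)
    (hinv : \forall w \ae P, normal_mx gamma (X ^~ w) \in unitmx)
    (hK2 : (K2 gamma X < +oo)%E)
    (f : T -> R) (hf : f \in Lfun mu 2%:E)
    (alpha : 'cV[R]_n) (halpha : least_squares_solution mu f gamma alpha),
    let beta := fun w => estimator f gamma (X ^~ w) in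
    (forall j, (fun w => beta w j ord0) \in Lfun P 1%:E) /\
    ((norm2 (mean_vec P beta - alpha))%:E <=
      (Cst n C (fine (K2 gamma X)))%:E *
      'N[mu]_2%:E[EFin \o residue f gamma alpha])%E.
Proof.
(* [C * n] bounds [m], on which the constant may not depend. *)
exists (fun n C K => Num.sqrt (C * n%:R * K)).
move=> n m hn hm C hC dT T mu dW W P X hX gamma hgamma hinv hK2 f hf alpha _.
move=> beta.
have mLfun (g : T -> R) : g \in Lfun mu 2%:E -> measurable_fun setT g.
  by rewrite inE => /andP[]; rewrite inE.
have Lres := Lfun_residue alpha hf hgamma.
have mbeta : measurable_mx beta.
  by apply: measurable_estimator => [|j]; exact: mLfun.
have merr : measurable_mx (fun w => beta w - alpha).
  move=> i j; under eq_fun do rewrite mxE [X in _ + X]mxE.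
  exact: measurable_funB.
set rho := residue f gamma alpha in Lres *.
set K := fine (K2 gamma X); set N := 'N[mu]_2%:E[EFin \o rho]%E.
have k0 w := inv_smallest_eigenvalue_ge0 gamma (X ^~ w) hn.
have K0 : (0 <= K2 gamma X)%E by exact: integral_ge0.
have Kfin : K2 gamma X = K%:E by rewrite fineK// ge0_fin_numE.
have Nfin : N = (fine N)%:E.
  rewrite fineK// ge0_fin_numE ?Lnorm_ge0//.
  by move: Lres; rewrite inE => /andP[_]; rewrite inE.
have N0 : 0 <= fine N by rewrite fine_ge0// Lnorm_ge0.
have mean_error : (\int[P]_w (norm2 (beta w - alpha))%:E <=
    (Num.sqrt (C * n%:R * K))%:E * N)%E.
  apply: (@le_trans _ _ (Num.sqrt K * Num.sqrt (m%:R * fine N ^+ 2))%:E).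
    apply: (@cauchy_schwarz_dominated _ _ _ P _
      (fun w => norm2 (sample_vec rho (X ^~ w)))
      (fun w => ((smallest_eigenvalue (normal_mx gamma (X ^~ w)))%:E)^-1)%E).
    - exact: measurable_norm2.
    - exact/measurable_norm2/measurable_sample_vec/mLfun.
    - by move=> w; exact: norm2_ge0.
    - by move=> w; exact: norm2_ge0.
    - exact: k0.
    - by apply: filterS hinv => w; exact: norm2_estimator_error_le.
    - by rewrite -Kfin.
    - by rewrite (integral_sqr_norm2_sample_vec (mu := mu))//; case: hX.
  rewrite Nfin -EFinM lee_fin sqrtrM// sqrtr_sqr (ger0_norm N0) mulrA.
  rewrite ler_wpM2r// -sqrtrM ?fine_ge0// ler_wsqrtr// mulrC.
  by rewrite ler_wpM2r// fine_ge0.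
have Lerr j : (fun w => (beta w - alpha) j ord0) \in Lfun P 1%:E.
  apply: (@Lfun1_dominated _ _ _ P _ (fun w => norm2 (beta w - alpha))) => //.
    by move=> w; exact: entry_le_norm2.
  by apply: le_lt_trans mean_error _; rewrite Nfin -EFinM ltry.
have Lbeta j : (fun w => beta w j ord0) \in Lfun P 1%:E.
  have [_ LD] := Lfun_addr_closed P (lexx (1%E : \bar R)).
  have -> : (fun w => beta w j ord0) =
      (fun w => (beta w - alpha) j ord0) + cst (alpha j ord0).
    by apply/funext => w; rewrite fctE /= [in RHS]mxE [(- alpha) _ _]mxE subrK.
  exact: LD _ _ (Lerr j) (Lfun_cst P (alpha j ord0) 1).
split=> //; rewrite -mean_vec_subr//; apply: le_trans mean_error.
exact: norm2_mean_vec_le.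
Qed.
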